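(* Let $R$ be a $\mathbb{Z}$-graded commutative ring with unity, and let $M$ and $N$ be $\mathbb{Z}$-graded $R$-modules with $N$ Noetherian. For every $\mathfrak p\in\operatorname{Ass}_R(N)$, let $r(\mathfrak p):=\operatorname{rank}_{R_{(\mathfrak p)}/\mathfrak p_{(\mathfrak p)}}(\operatorname{Soc}_{R_{(\mathfrak p)}}(N_{(\mathfrak p)}))$, let $P(\mathfrak p):=\{\mathfrak p'\in\operatorname{Ass}_R(N):\mathfrak p'_0=\mathfrak p_0\}$, and assume that $|R_0/\mathfrak p_0|>\sum_{\mathfrak p'\in P(\mathfrak p)}r(\mathfrak p')$. Let $F$ be a $\mathbb{Z}$-graded $R$-submodule of $\operatorname{Hom}_R(N,M)$. Assume that there exists a degree $i\in\mathbb{Z}$ such that, for every $\mathfrak p\in\operatorname{Ass}_R(N)$, the $i$th homogeneous component $F_i$ of $F$ contains a map that becomes injective after homogeneous localization at $\mathfrak p$. Then $F_i$ contains an injection.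
   Context: A $\mathbb{Z}$-grading on $R$ is a decomposition $R=\bigoplus_{i\in\mathbb{Z}}R_i$ of abelian groups with $R_iR_j\subseteq R_{i+j}$; a $\mathbb{Z}$-grading on an $R$-module $M$ is a decomposition $M=\bigoplus_{i\in\mathbb{Z}}M_i$ of abelian groups with $R_iM_j\subseteq M_{i+j}$. $M_i$ is the $i$th homogeneous component of $M$. For a graded ideal $\mathfrak p$, $\mathfrak p_0=\mathfrak p\cap R_0$ is its degree-$0$ component. Since $N$ is Noetherian, every member of the (finite) set $\operatorname{Ass}_R(N)$ of associated primes of $N$ is a $\mathbb{Z}$-graded ideal, and $\operatorname{Hom}_R(N,M)$ is a $\mathbb{Z}$-graded $R$-module whose $i$th homogeneous component consists of all $f$ with $f(N_j)\subseteq M_{i+j}$ for every $j\in\mathbb{Z}$. For $\mathfrak p\in\operatorname{Spec}(R)$, let $S$ be the set of all homogeneous elements of $R$ not in $\mathfrak p$; the homogeneous localization $M_{(\mathfrak p)}$ is the $\mathbb{Z}$-graded $S^{-1}R$-module $S^{-1}M$, whose $i$th homogeneous component is the set of all $x/s$ with $x\in M_{i+j}$ and $s\in R_j\setminus\mathfrak p$ for some $j\in\mathbb{Z}$. In particular $R_{(\mathfrak p)}=S^{-1}R$ and $\mathfrak p_{(\mathfrak p)}=S^{-1}\mathfrak p$; the homogeneous localization of a map $f$ at $\mathfrak p$ is $f_{(\mathfrak p)}=S^{-1}f$. For a $\mathbb{Z}$-graded prime $\mathfrak p$, $\operatorname{Soc}_{R_{(\mathfrak p)}}(N_{(\mathfrak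 p)})$ is the $\mathbb{Z}$-graded module over $R_{(\mathfrak p)}/\mathfrak p_{(\mathfrak p)}$ consisting of all elements of $N_{(\mathfrak p)}$ annihilated by $\mathfrak p_{(\mathfrak p)}$ (every nonzero homogeneous element of $R_{(\mathfrak p)}/\mathfrak p_{(\mathfrak p)}$ is a unit, so graded modules over this ring are free and rank makes sense). A prime $\mathfrak p$ lies in $\operatorname{Ass}_R(N)$ if and only if $\mathfrak p$ is $\mathbb{Z}$-graded and $\operatorname{Soc}_{R_{(\mathfrak p)}}(N_{(\mathfrak p)})\neq 0$. *)

(* Defs.v *)
From HB Require Import structures.
From mathcomp Require Import all_boot all_order all_algebra.
From mathcomp Require Import finmap ring ring_quotient generic_quotient.
From mathcomp Require Import boolp classical_sets functions cardinality fsbigop.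

Set Implicit Arguments.
Unset Strict Implicit.
Unset Printing Implicit Defensive.

Import GRing.Theory.

Local Open Scope classical_set_scope.
Local Open Scope ring_scope.
Local Open Scope quotient_scope.

Definition is_subgroup (V : zmodType) (W : set V) : Prop :=
  W 0 /\ forall x y, W x -> W y -> W (x - y).

Definition is_submodule (R : pzRingType) (V : lmodType R) (W : set V) : Prop :=
  W 0 /\ forall (a : R) x y, W x -> W y -> W (a *: x + y).

Definition noetherian (R : pzRingType) (V : lmodType R) : Prop :=
  forall W : set V, is_submodule W ->
    exists (n : nat) (b : 'I_n -> V),
      W = [set x | exists a : 'I_n -> R, x = \sum_(k < n) a k *: b k].

Definition is_basis (K : pzRingType) (V : lmodType K) n (b : 'I_n -> V) :
  Prop :=
  forall x : V, exists! a : 'I_n -> K, x = \sum_(k < n) a k *: b k.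

(* The rank of a free module of finite rank over a nontrivial commutative ring,
   where all bases have the same size; 0 if there is no finite basis. *)
Definition rank (K : comNzRingType) (V : lmodType K) : nat :=
  xget 0%N [set n | exists b : 'I_n -> V, is_basis b].

Definition Hommod (R : comPzRingType) (N M : lmodType R) : Type :=
  {linear N -> M}.

Section HomModule.
Variables (R : comPzRingType) (N M : lmodType R).
Implicit Types (f g h : Hommod N M) (a b : R).

Lemma hom_ext f g : (forall x, f x = g x) -> f = g.
Proof.
case: f g => [f [[f1] [f2]]] [g [[g1] [g2]]] /= /funext fg.
by rewrite {}fg in f1 f2 *; congr (GRing.Linear.Pack (GRing.Linear.Class _ _));
  [congr GRing.isNmodMorphism.Axioms_|congr GRing.isScalable.Axioms_];
  exact: Prop_irrelevance.
Qed.

HB.instance Definition _ := gen_eqMixin (Hommod N M).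
HB.instance Definition _ := gen_choiceMixin (Hommod N M).

Definition hom_zero : Hommod N M := (\0 : N -> M) : {linear N -> M}.
Definition hom_opp f : Hommod N M := (\- f) : {linear N -> M}.
Definition hom_add f g : Hommod N M := (f \+ g) : {linear N -> M}.
Definition hom_scale a f : Hommod N M := (a \*: f) : {linear N -> M}.

Lemma hom_addA : associative hom_add.
Proof. by move=> f g h; apply: hom_ext => x /=; rewrite addrA. Qed.
Lemma hom_addC : commutative hom_add.
Proof. by move=> f g; apply: hom_ext => x /=; rewrite addrC. Qed.
Lemma hom_add0 : left_id hom_zero hom_add.
Proof. by move=> f; apply: hom_ext => x /=; rewrite add0r. Qed.
Lemma hom_addN : left_inverse hom_zero hom_opp hom_add.
Proof. by move=> f; apply: hom_ext => x /=; rewrite addNr. Qed.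
HB.instance Definition _ := GRing.isZmodule.Build (Hommod N M)
  hom_addA hom_addC hom_add0 hom_addN.

Lemma hom_scaleA a b f : hom_scale a (hom_scale b f) = hom_scale (a * b) f.
Proof. by apply: hom_ext => x /=; rewrite scalerA. Qed.
Lemma hom_scale1 : left_id 1 hom_scale.
Proof. by move=> f; apply: hom_ext => x /=; rewrite scale1r. Qed.
Lemma hom_scaleDr : right_distributive hom_scale +%R.
Proof. by move=> a f g; apply: hom_ext => x /=; rewrite scalerDr. Qed.
Lemma hom_scaleDl f : {morph hom_scale^~ f : a b / a + b}.
Proof. by move=> a b; apply: hom_ext => x /=; rewrite scalerDl. Qed.
HB.instance Definition _ := GRing.Zmodule_isLmodule.Build R (Hommod N M)
  hom_scaleA hom_scale1 hom_scaleDr hom_scaleDl.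

End HomModule.

Record mulset (R : pzRingType) := MulSet {
  mulset_carrier :> R -> Prop;
  mulset1 : mulset_carrier 1;
  mulsetM : forall s t, mulset_carrier s -> mulset_carrier t ->
    mulset_carrier (s * t) }.

Section Localization.
Variables (R : comPzRingType) (S : mulset R).

Definition denom : Type := set_type (mulset_carrier S).
HB.instance Definition _ := Choice.on denom.

Definition dval (s : denom) : R := val s.
Lemma denomP (s : denom) : S (dval s).
Proof. by have := valP s; rewrite in_setE. Qed.
Definition Denom s (Ss : S s) : denom := exist _ s (mem_set Ss).
Definition denom1 : denom := Denom (mulset1 S).
Definition denomM (s t : denom) : denom :=
  Denom (mulsetM (denomP s) (denomP t)).

Lemma dvalM s t : dval (denomM s t) = dval s * dval t. Proof. by []. Qed.
Lemma dval1 : dval denom1 = 1. Proof. by []. Qed.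

Section LocModule.
Variable M : lmodType R.
Implicit Types (x y z : M) (r s t u : denom).

(* (x, s) ~ (y, t) iff u (t x - s y) = 0 for some u in S. *)
Definition loc_equiv (a b : M * denom) : bool :=
  `[< exists t : denom,
        dval t *: (dval b.2 *: a.1) = dval t *: (dval a.2 *: b.1) >].

Lemma loc_equiv_equiv : equiv_class_of loc_equiv.
Proof.
split=> [a|a b|b a c].
- by apply/asboolP; exists denom1.
- by apply: asbool_equiv_eq; split=> -[t e]; exists t.
- move=> /asboolP[t e1] /asboolP[u e2]; apply/asboolP.
  exists (denomM (denomM t u) b.2); rewrite !scalerA in e1 e2 *.
  transitivity ((dval u * dval c.2) *: ((dval t * dval b.2) *: a.1)).
    by rewrite scalerA; congr (_ *: _); rewrite !dvalM; ring.
  rewrite e1 scalerA.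
  transitivity ((dval t * dval a.2) *: ((dval u * dval c.2) *: b.1)).
    by rewrite scalerA; congr (_ *: _); ring.
  by rewrite e2 scalerA; congr (_ *: _); rewrite !dvalM; ring.
Qed.

Canonical loc_equiv_rel := EquivRelPack loc_equiv_equiv.
Canonical loc_enc := defaultEncModRel loc_equiv.

Definition loc : Type := {eq_quot loc_equiv}.
HB.instance Definition _ : EqQuotient (M * denom)%type loc_equiv loc :=
  EqQuotient.on loc.
HB.instance Definition _ := Choice.on loc.

Definition frac x s : loc := \pi_loc (x, s).

Lemma frac_eqP x s y t :
  frac x s = frac y t <->
    exists u, dval u *: (dval t *: x) = dval u *: (dval s *: y).
Proof.
split=> [/eqP|H]; first by rewrite piE => /asboolP.
by apply/eqP; rewrite piE; apply/asboolP. Qed.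

Lemma frac_eq x s y t : dval t *: x = dval s *: y -> frac x s = frac y t.
Proof. by move=> e; apply/frac_eqP; exists denom1; rewrite e. Qed.

Lemma fracW (P : loc -> Prop) : (forall x s, P (frac x s)) -> forall a, P a.
Proof. by move=> H a; rewrite -[a]reprK; case: (repr a). Qed.

Definition loc_zero : loc := frac 0 denom1.
Definition loc_opp (a : loc) : loc := frac (- (repr a).1) (repr a).2.
Definition loc_add (a b : loc) : loc :=
  frac (dval (repr b).2 *: (repr a).1 + dval (repr a).2 *: (repr b).1)
       (denomM (repr a).2 (repr b).2).

Lemma repr_frac x s : frac (repr (frac x s)).1 (repr (frac x s)).2 = frac x s.
Proof. by rewrite /frac -[RHS]reprK -surjective_pairing. Qed.

Lemma loc_oppE x s : loc_opp (frac x s) = frac (- x) s.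
Proof.
have /frac_eqP[u e] := repr_frac x s; apply/frac_eqP; exists u.
by rewrite !scalerN e.
Qed.

Lemma loc_addE x s y t :
  loc_add (frac x s) (frac y t) = frac (dval t *: x + dval s *: y) (denomM s t).
Proof.
rewrite /loc_add.
have /frac_eqP := repr_frac x s; have /frac_eqP := repr_frac y t.
move: (repr (frac x s)) (repr (frac y t)) => [x' s'] [y' t'] /= [v ey] [u ex].
apply/frac_eqP; exists (denomM u v).
rewrite !dvalM !scalerDr !scalerA in ex ey *; congr (_ + _).
  transitivity ((dval v * dval t * dval t') *: ((dval u * dval s) *: x')).
    by rewrite scalerA; congr (_ *: _); ring.
  by rewrite ex scalerA; congr (_ *: _); ring.
transitivity ((dval u * dval s * dval s') *: ((dval v * dval t) *: y')).
  by rewrite scalerA; congr (_ *: _); ring.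
by rewrite ey scalerA; congr (_ *: _); ring.
Qed.

Lemma loc_addA : associative loc_add.
Proof.
elim/fracW=> x s; elim/fracW=> y t; elim/fracW=> z u.
rewrite !loc_addE; apply: frac_eq; rewrite !dvalM !scalerDr !scalerA !addrA.
by congr (_ *: _ + _ *: _ + _ *: _); ring.
Qed.

Lemma loc_addC : commutative loc_add.
Proof.
elim/fracW=> x s; elim/fracW=> y t; rewrite !loc_addE; apply: frac_eq.
rewrite !dvalM !scalerDr !scalerA addrC.
by congr (_ *: _ + _ *: _); ring.
Qed.

Lemma loc_add0 : left_id loc_zero loc_add.
Proof.
elim/fracW=> x s; rewrite loc_addE; apply: frac_eq.
by rewrite dvalM dval1 scaler0 add0r scale1r mul1r.
Qed.

Lemma loc_addN : left_inverse loc_zero loc_opp loc_add.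
Proof.
elim/fracW=> x s; rewrite loc_oppE loc_addE; apply: frac_eq.
by rewrite scalerN addNr !scaler0.
Qed.

HB.instance Definition _ :=
  GRing.isZmodule.Build loc loc_addA loc_addC loc_add0 loc_addN.

Lemma fracD x s y t :
  frac x s + frac y t = frac (dval t *: x + dval s *: y) (denomM s t).
Proof. exact: loc_addE. Qed.
End LocModule.

Definition locring : Type := loc R^o.
HB.instance Definition _ := GRing.Zmodule.on locring.

Definition fracr (a : R) (s : denom) : locring := frac (a : R^o) s.

Section LocScale.
Variable M : lmodType R.

Definition loc_scale (a : locring) (b : loc M) : loc M :=
  frac ((repr a).1 *: (repr b).1) (denomM (repr a).2 (repr b).2).

Lemma loc_scaleE a s (x : M) t :
  loc_scale (fracr a s) (frac x t) = frac (a *: x) (denomM s t).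
Proof.
rewrite /loc_scale.
have /frac_eqP := repr_frac (a : R^o) s; have /frac_eqP := repr_frac x t.
rewrite -/(fracr a s).
move: (repr (fracr a s)) (repr (frac x t)) => [a' s'] [x' t'] /= [v ex] [u ea].
apply/frac_eqP; exists (denomM u v).
have {}ea : dval u * (dval s * a') = dval u * (dval s' * a) := ea.
rewrite !dvalM !scalerA in ex *.
transitivity ((dval u * (dval s * a')) *: ((dval v * dval t) *: x')).
  by rewrite scalerA; congr (_ *: _); ring.
by rewrite ea ex scalerA; congr (_ *: _); ring.
Qed.
End LocScale.

Definition loc_mul : locring -> locring -> locring := @loc_scale R^o.
Definition loc_one : locring := fracr 1 denom1.

Lemma loc_mulE a s b t :
  loc_mul (fracr a s) (fracr b t) = fracr (a * b) (denomM s t).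
Proof. exact: loc_scaleE. Qed.

Lemma fracr_eq a s b t : dval t * a = dval s * b -> fracr a s = fracr b t.
Proof. by move=> e; apply: (@frac_eq R^o a s b t); exact: e. Qed.

Lemma fracrW (P : locring -> Prop) :
  (forall a s, P (fracr a s)) -> forall a, P a.
Proof. by move=> H a; apply: (@fracW R^o P). Qed.

Lemma fracrD a s b t :
  fracr a s + fracr b t = fracr (dval t * a + dval s * b) (denomM s t).
Proof. exact: fracD. Qed.

Lemma loc_mulA : associative loc_mul.
Proof.
elim/fracrW=> a s; elim/fracrW=> b t; elim/fracrW=> c u.
by rewrite !loc_mulE; apply: fracr_eq; rewrite !dvalM; ring.
Qed.

Lemma loc_mulC : commutative loc_mul.
Proof.
elim/fracrW=> a s; elim/fracrW=> b t.
by rewrite !loc_mulE; apply: fracr_eq; rewrite !dvalM; ring.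
Qed.

Lemma loc_mul1 : left_id loc_one loc_mul.
Proof.
elim/fracrW=> a s; rewrite loc_mulE; apply: fracr_eq.
by rewrite !dvalM dval1; ring.
Qed.

Lemma loc_mulDl : left_distributive loc_mul +%R.
Proof.
elim/fracrW=> a s; elim/fracrW=> b t; elim/fracrW=> c u.
rewrite !(fracrD, loc_mulE); apply: fracr_eq; rewrite !dvalM; ring.
Qed.

HB.instance Definition _ := GRing.Zmodule_isComPzRing.Build locring
  loc_mulA loc_mulC loc_mul1 loc_mulDl.

Lemma fracrM a s b t : fracr a s * fracr b t = fracr (a * b) (denomM s t).
Proof. exact: loc_mulE. Qed.

Section LocLmodule.
Variable M : lmodType R.

Lemma loc_scaleA (a b : locring) (c : loc M) :
  loc_scale a (loc_scale b c) = loc_scale (a * b) c.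
Proof.
elim/fracrW: a => a s; elim/fracrW: b => b t; elim/fracW: c => x u.
rewrite fracrM !loc_scaleE; apply: frac_eq; rewrite !dvalM !scalerA.
by congr (_ *: _); ring.
Qed.

Lemma loc_scale1 : left_id 1 (@loc_scale M).
Proof.
elim/fracW=> x s; rewrite loc_scaleE; apply: frac_eq.
by rewrite dvalM dval1 !scale1r mul1r.
Qed.

Lemma loc_scaleDr : right_distributive (@loc_scale M) +%R.
Proof.
elim/fracrW=> a s; elim/fracW=> x t; elim/fracW=> y u.
rewrite !(fracD, loc_scaleE); apply: frac_eq.
rewrite !dvalM !scalerDr !scalerA; congr (_ *: _ + _ *: _); ring.
Qed.

Lemma loc_scaleDl (c : loc M) : {morph (@loc_scale M)^~ c : a b / a + b}.
Proof.
elim/fracrW=> a s; elim/fracrW=> b t; elim/fracW: c => x u.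
rewrite fracrD !(fracD, loc_scaleE); apply: frac_eq.
rewrite !dvalM !scalerDr !scalerA -scalerDl; congr (_ *: _); ring.
Qed.

HB.instance Definition _ := GRing.Zmodule_isLmodule.Build locring (loc M)
  loc_scaleA loc_scale1 loc_scaleDr loc_scaleDl.

Lemma fracZ a s (x : M) t : fracr a s *: frac x t = frac (a *: x) (denomM s t).
Proof. exact: loc_scaleE. Qed.
End LocLmodule.

Section LocMap.
Variables (M N : lmodType R) (f : {linear M -> N}).

Definition loc_map (a : loc M) : loc N := frac (f (repr a).1) (repr a).2.

Lemma loc_mapE x s : loc_map (frac x s) = frac (f x) s.
Proof.
rewrite /loc_map; have /frac_eqP[u e] := repr_frac x s.
apply/frac_eqP; exists u; have := congr1 f e; rewrite !(linearZZ f); exact.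
Qed.

Lemma loc_map_linear : linear loc_map.
Proof.
elim/fracrW=> a s; elim/fracW=> x t; elim/fracW=> y u.
rewrite fracZ fracD 3!loc_mapE fracZ fracD; congr frac.
by rewrite linearD !(linearZZ f).
Qed.
HB.instance Definition _ :=
  GRing.isLinear.Build locring (loc M) (loc N) *:%R loc_map loc_map_linear.
End LocMap.
End Localization.

Section Socle.
Variables (A : comNzRingType) (I : idealr A) (V : lmodType A).

Definition killed : {pred V} := fun v => `[< forall a, a \in I -> a *: v = 0 >].

Lemma killed_submod : submod_closed killed.
Proof.
split; first by apply/asboolP => a _; rewrite scaler0.
move=> a u v /asboolP u0 /asboolP v0; apply/asboolP => b bI.
by rewrite scalerDr scalerA mulrC -scalerA u0// v0// scaler0 addr0.
Qed.
HB.instance Definition _ := GRing.isSubmodClosed.Build A V killed killed_submod.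

(* The submodule of V annihilated by I, as a module over A / I. *)
Record socle : Type := Socle { socle_val : V; _ : socle_val \in killed }.
HB.instance Definition _ := [isSub for socle_val].
HB.instance Definition _ := [Choice of socle by <:].
HB.instance Definition _ := [SubChoice_isSubZmodule of socle by <:].

Lemma socle_scale_subproof (a : A) (v : socle) : a *: val v \in killed.
Proof. by rewrite rpredZ // (valP v). Qed.

Definition socle_scale (a : {ideal_quot I}) (v : socle) : socle :=
  Socle (socle_scale_subproof (repr a) v).

Definition qproj (a : A) : {ideal_quot I} := \pi a.

Lemma qprojD a b : qproj a + qproj b = qproj (a + b).
Proof. by rewrite /qproj piE. Qed.
Lemma qprojM a b : qproj a * qproj b = qproj (a * b).
Proof. by rewrite /qproj piE. Qed.
Lemma qproj1 : 1 = qproj 1.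
Proof. by rewrite /qproj piE. Qed.
Lemma qprojW (P : {ideal_quot I} -> Prop) :
  (forall a, P (qproj a)) -> forall a, P a.
Proof. by move=> H a; rewrite -[a]reprK; apply: H. Qed.

Lemma socle_scaleE (a : A) (v : socle) :
  socle_val (socle_scale (qproj a) v) = a *: socle_val v.
Proof.
apply/eqP; rewrite -subr_eq0 /= -scalerBl; apply/eqP.
have /asboolP -> // := valP v.
by rewrite Quotient.idealrBE reprK.
Qed.

Lemma socle_scaleA a b v :
  socle_scale a (socle_scale b v) = socle_scale (a * b) v.
Proof.
elim/qprojW: a => a; elim/qprojW: b => b; rewrite qprojM; apply: val_inj.
rewrite -![val _]/(socle_val _).
by rewrite !socle_scaleE scalerA.
Qed.

Lemma socle_scale1 : left_id 1 socle_scale.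
Proof.
move=> v; rewrite qproj1; apply: val_inj; rewrite -![val _]/(socle_val _).
by rewrite socle_scaleE scale1r.
Qed.

Lemma socle_valD : {morph socle_val : u v / u + v}.
Proof. by move=> u v; rewrite -![socle_val _]/(val _) raddfD. Qed.

Lemma socle_scaleDr : right_distributive socle_scale +%R.
Proof.
elim/qprojW=> a u v; apply: val_inj; rewrite -![val _]/(socle_val _).
by rewrite socle_valD !socle_scaleE socle_valD scalerDr.
Qed.

Lemma socle_scaleDl v : {morph socle_scale^~ v : a b / a + b}.
Proof.
elim/qprojW=> a; elim/qprojW=> b; rewrite qprojD; apply: val_inj.
rewrite -![val _]/(socle_val _).
by rewrite socle_valD !socle_scaleE scalerDl.
Qed.

HB.instance Definition _ := GRing.Zmodule_isLmodule.Build {ideal_quot I} socle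
  socle_scaleA socle_scale1 socle_scaleDr socle_scaleDl.
End Socle.

(* W is the internal direct sum of the subgroups C i. *)
Definition direct_sum (V : zmodType) (W : set V) (C : int -> set V) : Prop :=
  [/\ forall i, is_subgroup (C i),
      forall i, C i `<=` W &
      forall x, W x -> exists! c : int -> V,
        [/\ forall i, C i (c i), finite_set [set i | c i != 0] &
            x = \sum_(i \in [set: int]) c i]].

Record ring_grading (R : pzRingType) := RingGrading {
  ring_comp :> int -> set R;
  ring_comp_sum : direct_sum [set: R] ring_comp;
  ring_compM : forall i j a b,
    ring_comp i a -> ring_comp j b -> ring_comp (i + j) (a * b) }.

Record mod_grading (R : pzRingType) (gR : ring_grading R) (M : lmodType R) :=
  ModGrading {
    mod_comp :> int -> set M;
    mod_comp_sum : direct_sum [set: M] mod_comp;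
    mod_compZ : forall i j a x,
      gR i a -> mod_comp j x -> mod_comp (i + j) (a *: x) }.

(* The components of a graded submodule F are the F `&` C i; stability of these
   under the action of homogeneous scalars is then automatic. *)
Definition is_graded_submodule (R : pzRingType) (V : lmodType R)
    (C : int -> set V) (F : set V) : Prop :=
  is_submodule F /\ direct_sum F (fun i => F `&` C i).

Section Graded.
Variables (R : comPzRingType) (gR : ring_grading R).

Definition hom_comp (N M : lmodType R) (gN : mod_grading gR N)
    (gM : mod_grading gR M) (i : int) : set (Hommod N M) :=
  [set f | forall j x, gN j x -> gM (i + j) (f x)].

Lemma grading_sum_uniq (c d : int -> R) :
  (forall i, gR i (c i)) -> (forall i, gR i (d i)) ->
  finite_set [set i | c i != 0] -> finite_set [set i | d i != 0] ->
  \sum_(i \in [set: int]) c i = \sum_(i \in [set: int]) d i -> c = d.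
Proof.
move=> gc gd fc fd e; have [_ _ dec] := ring_comp_sum gR.
have [b [_ b_uniq]] := dec (\sum_(i \in [set: int]) c i) I.
by rewrite -(b_uniq c)// -(b_uniq d).
Qed.

Lemma ring_comp0 i : gR i 0.
Proof. by have [/(_ i)[]] := ring_comp_sum gR. Qed.

Lemma ring_comp1 : gR 0 1.
Proof.
have [_ _ dec] := ring_comp_sum gR.
have [c [[gc fc e1] _]] := dec 1 I.
have sumMx x : 1 * x = \sum_(i \in [set: int]) (c i * x).
  have [X EX] : exists X : {fset int}, [set i | c i != 0] = [set` X].
    by apply/finite_fsetP.
  have cX i : i \notin X -> c i = 0.
    move=> iX; apply: contraNeq iX => ci.
    by have : [set i | c i != 0] i by []; rewrite EX.
  rewrite [in LHS]e1 (fsbigTE X)// (fsbigTE X) ?mulr_suml// => i iX.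
  by rewrite cX// mul0r.
have c0K j x : gR j x -> c 0 * x = x.
  move=> gx; pose d k := if k == j then x else 0.
  have /(congr1 (@^~ j)) : (fun k => c (k - j) * x) = d.
    apply: grading_sum_uniq.
    - by move=> k; rewrite -{1}[k](subrK j); apply: ring_compM.
    - move=> k; rewrite /d; case: eqP => [->//|_]; exact: ring_comp0.
    - apply: (@sub_finite_set _ _ ((fun k => k + j) @` [set i | c i != 0])).
        move=> k /= ck; exists (k - j); last by rewrite subrK.
        by apply: contra_neq ck => ->; rewrite mul0r.
      exact: finite_image.
    - apply: (@sub_finite_set _ _ [set j]); last exact: finite_set1.
      by move=> k /=; rewrite /d; case: (k =P j) => // _ /eqP.
    transitivity x.
      rewrite -[RHS]mul1r sumMx; symmetry.
      rewrite (@reindex_fsbigT _ _ _ _ _ (fun k => k - j))//.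
      by exists (fun k => k + j) => k; rewrite ?subrK ?addrK.
    rewrite -(@fsbig_widen _ _ _ _ [set j]) ?fsbig_set1 /d ?eqxx//.
    by move=> k /= [_ /eqP/negPf ->].
  by rewrite subrr /d eqxx.
suff -> : 1 = c 0 by exact: gc.
rewrite -[RHS]mulr1 [in RHS]e1.
have [X EX] : exists X : {fset int}, [set i | c i != 0] = [set` X].
  by apply/finite_fsetP.
have cX i : i \notin X -> c i = 0.
  move=> iX; apply: contraNeq iX => ci.
  by have : [set i | c i != 0] i by []; rewrite EX.
rewrite [LHS]e1 !(fsbigTE X)// mulr_sumr; apply: eq_bigr => i _.
by rewrite (c0K i).
Qed.

(* Prime ideals; the zero ring has none. *)
Record spec := Spec {
  spec_ideal :> R -> Prop;
  spec0 : spec_ideal 0;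
  spec_lin : forall a x y,
    spec_ideal x -> spec_ideal y -> spec_ideal (a * x + y);
  spec_proper : ~ spec_ideal 1;
  spec_prime : forall x y,
    spec_ideal (x * y) -> spec_ideal x \/ spec_ideal y }.
HB.instance Definition _ := gen_eqMixin spec.
HB.instance Definition _ := gen_choiceMixin spec.

Definition annihilator (V : lmodType R) (x : V) : set R :=
  [set a | a *: x = 0].

Definition Ass (V : lmodType R) : set spec :=
  [set p | exists x : V, (p : set R) = annihilator x].

Section HomogLoc.
Variable p : spec.

(* Homogeneous localization at p: R_(p) is hlocring, M_(p) is hlocmod M,
   p_(p) is hlocideal, and R_(p) / p_(p) is residue_hlocring. *)
Definition homog_compl : set R := [set s | (exists i, gR i s) /\ ~ p s].

Lemma homog_compl1 : homog_compl 1.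
Proof. by split; [exists 0; exact: ring_comp1|exact: spec_proper]. Qed.

Lemma homog_complM s t :
  homog_compl s -> homog_compl t -> homog_compl (s * t).
Proof.
move=> [[i gs] ps] [[j gt] pt]; split.
  by exists (i + j); exact: ring_compM.
by move=> /spec_prime[].
Qed.

Definition homog_mulset : mulset R := MulSet homog_compl1 homog_complM.

Definition hlocring : Type := locring homog_mulset.
HB.instance Definition _ := GRing.ComPzRing.on hlocring.

Lemma hlocring1_neq0 : (1 : hlocring) != 0.
Proof.
apply/eqP => /frac_eqP[u] /=; rewrite dval1 !scaler0 scale1r.
move=> e; have [_] := denomP u; apply.
have -> : dval u = 0 by rewrite -[LHS]mulr1; exact: e.
exact: spec0.
Qed.
HB.instance Definition _ :=
  GRing.PzSemiRing_isNonZero.Build hlocring hlocring1_neq0.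

Definition hlocmod (M : lmodType R) : Type := loc homog_mulset M.
HB.instance Definition _ M := GRing.Zmodule.on (hlocmod M).
HB.instance Definition _ M :=
  GRing.Lmodule.copy (hlocmod M) (loc homog_mulset M).

Definition hlocideal : {pred hlocring} := fun a =>
  `[< exists x s, p x /\ a = fracr x s >].

Lemma hlocideal_closed : idealr_closed hlocideal.
Proof.
split.
- by apply/asboolP; exists 0, (denom1 _); split => //; exact: spec0.
- apply/negP => /asboolP[x [s [px]]] /frac_eqP[u].
  rewrite dval1 scale1r => e.
  have {}e : dval u * (dval s * 1) = dval u * x := e.
  have : p (dval u * (dval s * 1)).
    by rewrite e -[_ * x]addr0; apply: spec_lin => //; exact: spec0.
  by rewrite mulr1 => /spec_prime[]; [have [] := denomP u|have [] := denomP s].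
- move=> a u v /asboolP[x [s [px ->]]] /asboolP[y [t [py ->]]]; apply/asboolP.
  elim/fracrW: a => a r; rewrite fracrM fracrD; do 2!eexists; split; last by [].
  rewrite mulrA; apply: spec_lin => //.
  by rewrite -[_ * y]addr0; apply: spec_lin => //; exact: spec0.
Qed.
HB.instance Definition _ := isIdealr.Build hlocring hlocideal hlocideal_closed.

Definition residue_hlocring : comNzRingType := {ideal_quot hlocideal}.

Definition hloc_socle (N : lmodType R) : lmodType residue_hlocring :=
  socle hlocideal (hlocmod N).

Definition hloc_map (N M : lmodType R) (f : {linear N -> M}) :
  hlocmod N -> hlocmod M := @loc_map R homog_mulset N M f.

(* The degree 0 component p_0 and the set R_0 / p_0 of its cosets in R_0. *)
Definition spec_comp0 : set R := [set a | p a /\ gR 0 a].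

Definition residue0 : set (set R) :=
  [set [set a + b | b in spec_comp0] | a in gR 0].
End HomogLoc.

Definition socle_rank (N : lmodType R) (p : spec) : nat :=
  rank (hloc_socle p N).

Definition same_degree0 (N : lmodType R) (p : spec) : set spec :=
  [set p' | Ass N p' /\ spec_comp0 p' = spec_comp0 p].

End Graded.

Arguments hloc_map {R} gR p {N M} f.

(* Main.v *)
(** A map [f : N -> M] is injective as soon as it kills no [x] whose annihilator
    is an associated prime, because a nonzero kernel has an associated prime.
    Call [f] good at [p] if it kills no [x] with annihilator [p].  Treat the
    associated primes in an order in which larger degree 0 parts come first; to
    pass from [f], good at the primes treated so far, to a map which is also
    good at [p], replace [f] by [f + (b * c) *: g], where [g] is good at [p],
    where [b] of degree 0 lies outside [p] but in every treated [q] with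
    [q_0 <> p_0], and where [c] has degree 0.  If this fails at [q] for several
    [c] that are pairwise incongruent modulo [p_0], then the elements killed are
    eigenvectors of the pencil [(f, g)] for distinct eigenvalues, so they are
    linearly independent in the socle of [N_(q)]; hence at most [r(q)] residues
    of [c] fail at [q].  The socle is free because a maximal linearly
    independent family of homogeneous elements spans it. *)

Require Import Defs.
From mathcomp Require Import all_boot all_order all_algebra.
From mathcomp Require Import finmap zify ring.
From mathcomp Require Import boolp classical_sets functions cardinality fsbigop.

Import Order.TTheory GRing.Theory.

Set Implicit Arguments.
Unset Strict Implicit.
Unset Printing Implicit Defensive.

Local Open Scope classical_set_scope.
Local Open Scope card_scope.
Local Open Scope ring_scope.

(** * Associated primes of Noetherian modules *)

Section Noetherian.
Context {R : comPzRingType} {V : lmodType R}.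
Implicit Types (W : set V) (x y : V) (a b : R).

Lemma is_submoduleZ W a x : is_submodule W -> W x -> W (a *: x).
Proof. by move=> [W0 WD] Wx; rewrite -[_ *: _]addr0; exact: WD. Qed.

Lemma is_submoduleD W x y : is_submodule W -> W x -> W y -> W (x + y).
Proof. by move=> [W0 WD] Wx Wy; rewrite -[x]scale1r; exact: WD. Qed.

Lemma is_submoduleB W x y : is_submodule W -> W x -> W y -> W (x - y).
Proof.
by move=> sW Wx Wy; rewrite -scaleN1r; apply: is_submoduleD=> //;
  apply: is_submoduleZ.
Qed.

Lemma is_submodule_sum W (I : Type) (s : seq I) (P : pred I) (F : I -> V) :
  is_submodule W -> (forall i, P i -> W (F i)) -> W (\sum_(i <- s | P i) F i).
Proof.
move=> sW WF; elim/big_ind: _ => //; first by case: sW.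
by move=> x y; exact: is_submoduleD.
Qed.

(** Otherwise choice yields a strictly ascending chain in [P]; its union is finitely generated, and
    the generators already lie in one member. *)
Lemma noetherian_max (P : set (set V)) :
  noetherian V -> (forall W, P W -> is_submodule W) -> P !=set0 ->
  exists2 W, P W & forall W', P W' -> W `<=` W' -> W' `<=` W.
Proof.
move=> noeth subP [W0 PW0]; apply: contrapT => nomax.
have /choice[next nextP] : forall W, exists W', P W ->
    [/\ P W', W `<=` W' & ~ W' `<=` W].
  move=> W; apply: contrapT => noW; have PW : P W.
    by apply: contrapT => nPW; apply: noW; exists W.
  apply: nomax; exists W => // W' PW' WW'; apply: contrapT => W'W.
  by apply: noW; exists W'.
pose c n := iter n next W0.
have Pc n : P (c n) by elim: n => //= n /nextP[].
have c_mono m n : (m <= n)%N -> c m `<=` c n.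
  move/subnK <-; elim: (n - m)%N => //= k IH x /IH.
  by have [_ + _] := nextP _ (Pc (k + m)%N); apply.
pose U := [set x | exists n, c n x].
have [|n [b Ub]] := noeth U.
  split; first by exists 0%N; have [] := subP _ PW0.
  move=> a x y [m cx] [k cy]; exists (maxn m k).
  have sub := subP _ (Pc (maxn m k)).
  apply: is_submoduleD => //; last by apply: c_mono cy; exact: leq_maxr.
  by apply: is_submoduleZ => //; apply: c_mono cx; exact: leq_maxl.
have /choice[h hP] : forall k, exists m, c m (b k).
  move=> k; have : U (b k).
    rewrite Ub /=; exists (fun j => (j == k)%:R).
    rewrite (bigD1 k)//= eqxx scale1r big1 ?addr0// => j /negPf ->.
    by rewrite scale0r.
  by [].
pose m := \max_k h k.
have Um x : U x -> c m x.
  rewrite Ub => -[a ->]; apply: is_submodule_sum; first exact: subP.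
  move=> k _; apply: is_submoduleZ; first exact: subP.
  by apply: c_mono (hP k); exact: leq_bigmax.
have [_ _] := nextP _ (Pc m); apply => x cx; apply: Um.
by exists m.+1.
Qed.

Definition colon W x : set R := [set a | W (a *: x)].

Lemma is_submodule0 : is_submodule ([set 0] : set V).
Proof. by split=> // a x y /= -> ->; rewrite scaler0 addr0. Qed.

(** This produces associated primes of V / W without forming the quotient. The maximum condition
    concerns submodules of [V], so the ideals (W : a x) are compared through their images [v a] in R
    x. *)
Lemma exists_prime_colon W x : noetherian V -> is_submodule W -> ~ W x ->
  exists (p : spec R) (a : R), (p : set R) = colon W (a *: x).
Proof.
move=> noeth sW nWx.
(* [a *: x] has a prime colon as soon as [v a] is maximal. *)
pose v a := [set y | exists2 b, y = b *: x & W ((b * a) *: x)].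
have sub_v a : is_submodule (v a).
  split; first by exists 0; rewrite ?mul0r scale0r//; case: sW.
  move=> c _ _ [b1 -> W1] [b2 -> W2]; exists (c * b1 + b2).
    by rewrite scalerDl scalerA.
  rewrite mulrDl scalerDl; apply: is_submoduleD => //.
  by rewrite -mulrA -scalerA; exact: is_submoduleZ.
have [||_ [a [naW ->]] amax] :=
  @noetherian_max [set U | exists a, ~ W (a *: x) /\ U = v a] noeth.
- by move=> _ [a [_ ->]].
- by exists (v 1), 1; rewrite scale1r.
suff [p pE] : exists p : spec R, (p : set R) = colon W (a *: x) by exists p, a.
have prime_colon b c : colon W (a *: x) (b * c) ->
    colon W (a *: x) b \/ colon W (a *: x) c.
  rewrite /colon /= !scalerA => Wbc.
  have [|nWc] := pselect (W ((c * a) *: x)); first by right.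
  (* Maximality applies because [v a] lies in [v (c * a)]. It gives [b *: x = e *: x] with [e] in (W
     : a x), so [b] is in this ideal too. *)
  left; have : v (c * a) `<=` v a.
    apply: amax; first by exists (c * a).
    move=> _ [e -> We]; exists e => //.
    by rewrite mulrCA -scalerA; exact: is_submoduleZ.
  move=> /(_ (b *: x))[|e bx We]; first by exists b => //; rewrite mulrA.
  by rewrite mulrC -scalerA bx scalerA mulrC.
unshelve eexists; first apply: (@Spec R (colon W (a *: x))).
- by rewrite /colon/= scale0r; case: sW.
- move=> e b c Wb Wc; rewrite /colon/= scalerDl -scalerA.
  by apply: is_submoduleD => //; exact: is_submoduleZ.
- by rewrite /colon/= scale1r.
- exact: prime_colon.
- by [].
Qed.

Lemma spec_ext (p q : spec R) : (p : set R) = q -> p = q.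
Proof.
case: p q => [p p0 p1 p2 p3] [q q0 q1 q2 q3] /= e; move: e p0 p1 p2 p3 => ->.
by move=> *; congr Spec; exact: Prop_irrelevance.
Qed.

Lemma specM (p : spec R) a b : p b -> p (a * b).
Proof.
by move=> pb; rewrite -[_ * _]addr0; apply: spec_lin => //; exact: spec0.
Qed.

Lemma specD (p : spec R) a b : p a -> p b -> p (a + b).
Proof. by move=> pa pb; rewrite -[a]mul1r; exact: spec_lin. Qed.

Lemma specB (p : spec R) a b : p a -> p b -> p (a - b).
Proof.
by move=> pa pb; rewrite -mulN1r addrC; apply: spec_lin.
Qed.

Lemma spec_prod (p : spec R) (I : Type) (s : seq I) (P : pred I) (F : I -> R) :
  (forall i, P i -> ~ p (F i)) -> ~ p (\prod_(i <- s | P i) F i).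
Proof.
move=> pF; elim/big_ind: _ => //; first exact: spec_proper.
by move=> a b pa pb /spec_prime[].
Qed.

Lemma annihilator_nz (p : spec R) x : (p : set R) = annihilator x -> x <> 0.
Proof.
move=> px x0; apply: (@spec_proper _ p).
by rewrite px /annihilator /= x0 scaler0.
Qed.

(** A submodule maximal among those with finitely many associated primes is everything: otherwise it
    could be enlarged by an element whose colon ideal is prime. *)
Lemma finite_Ass : noetherian V -> finite_set (Ass V).
Proof.
move=> noeth.
pose assW W := [set p : spec R | exists2 x, W x & (p : set R) = annihilator x].
have [||W [sW finW] Wmax] := @noetherian_max
  [set W | is_submodule W /\ finite_set (assW W)] noeth.
- by move=> W [].
- exists [set 0]; split; first exact: is_submodule0.
  rewrite (_ : assW _ = set0); first exact: finite_set0.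
  by apply/seteqP; split => // p [x /= -> /annihilator_nz].
suff WT x : W x.
  apply: sub_finite_set finW => p [x px]; by exists x.
apply: contrapT => nWx.
have [q [a qE]] := exists_prime_colon noeth sW nWx.
set y := a *: x in qE.
have nWy : ~ W y.
  move=> Wy; apply: (@spec_proper _ q); rewrite qE /colon /= scale1r.
  exact: Wy.
(* Passing from [W] to [W' = W + R y] adds at most the associated prime [q]. *)
pose W' := [set z | exists2 w, W w & exists b, z = w + b *: y].
apply: nWy; apply: (Wmax W'); last 2 first.
- by move=> w Ww; exists w => //; exists 0; rewrite scale0r addr0.
- by exists 0; [case: sW|exists 1; rewrite scale1r add0r].
split.
  split; first by exists 0; [case: sW|exists 0; rewrite scale0r addr0].
  move=> e _ _ [w1 Ww1 [b1 ->]] [w2 Ww2 [b2 ->]].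
  exists (e *: w1 + w2); first by case: sW => _; apply.
  by exists (e * b1 + b2); rewrite scalerDl -scalerA scalerDr addrACA.
apply: (@sub_finite_set _ _ (assW W `|` [set q])); last first.
  by rewrite finite_setU; split => //; exact: finite_set1.
move=> p [z [w Ww [b zE]] pz].
(* A nonzero multiple of [z] in [W] also has annihilator [p]. If there is none, [p] is the colon
   ideal of [z], hence of [b *: y], and this is [q] because [b] is not in [q]. *)
have [[e [We nze]]|noe] := pselect (exists e, W (e *: z) /\ e *: z <> 0).
  left; exists (e *: z) => //; apply/seteqP; split=> c; rewrite pz /annihilator/=.
    by move=> cz; rewrite scalerA mulrC -scalerA cz scaler0.
  rewrite scalerA => cz; have : p (c * e) by rewrite pz.
  by case/spec_prime; rewrite pz.
right; apply: spec_ext; apply/seteqP.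
have Wz e : W (e *: z) <-> p e.
  split=> [We|]; last by rewrite pz => /= ->; case: sW.
  by rewrite pz; apply: contrapT => nz; apply: noe; exists e.
have zy e : W (e *: z) <-> q (e * b).
  rewrite qE /colon/= zE scalerDr scalerA; split => [We|Wb].
    rewrite -[_ *: y](addKr (e *: w)) addrC.
    by apply: is_submoduleB => //; exact: is_submoduleZ.
  by apply: is_submoduleD => //; exact: is_submoduleZ.
have nqb : ~ q b by rewrite -[b]mul1r -zy Wz; exact: spec_proper.
split=> e.
  by move/Wz/zy/spec_prime => -[].
by move=> qe; apply/Wz/zy; rewrite mulrC; exact: specM.
Qed.

Lemma exists_Ass_in W : noetherian V -> is_submodule W ->
  (exists2 x, W x & x <> 0) ->
  exists2 p : spec R, Ass V p & exists2 x, W x & (p : set R) = annihilator x.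
Proof.
move=> noeth sW [x Wx nx].
have [p [a pE]] := exists_prime_colon noeth is_submodule0 nx.
exists p; first by exists (a *: x).
by exists (a *: x) => //; exact: is_submoduleZ.
Qed.

End Noetherian.

(** * Homogeneous components *)

Section Component.
Context {V : zmodType} {C : int -> set V} (dC : direct_sum [set: V] C).
Implicit Types (x y : V) (k : int).

Lemma decomposition_exists x : exists c : int -> V,
  [/\ forall k, C k (c k), finite_set [set k | c k != 0] &
      x = \sum_(k \in [set: int]) c k].
Proof. by have [_ _ /(_ x I)[c [cP _]]] := dC; exists c. Qed.

Definition component x : int -> V := sval (cid (decomposition_exists x)).

Lemma component_in x k : C k (component x k).
Proof. by rewrite /component; case: cid => c []. Qed.

Lemma component_support x : exists2 s : seq int, uniq s &
  (forall k, k \notin s -> component x k = 0) /\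
  x = \sum_(k <- s) component x k.
Proof.
rewrite /component; case: cid => c /= [_ /finite_fsetP[X EX] xE].
have cX k : k \notin X -> c k = 0.
  move=> kX; apply: contraNeq kX => ck.
  by have : [set k | c k != 0] k by []; rewrite EX.
exists X; first exact: fset_uniq.
by split=> //; rewrite {1}xE (fsbigTE X).
Qed.

Lemma component_uniq x (s : seq int) (d : int -> V) : uniq s ->
  (forall k, C k (d k)) -> (forall k, k \notin s -> d k = 0) ->
  x = \sum_(k <- s) d k -> component x =1 d.
Proof.
move=> us Cd sd xE k; have [_ _ /(_ x I)[c [_ c_uniq]]] := dC.
rewrite /component; case: cid => e /= eP; rewrite -(c_uniq _ eP).
rewrite (c_uniq d)//; split=> //.
  apply: (@sub_finite_set _ _ [set` s]); last exact: finite_seq.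
  by move=> j /= dj; apply: contraNT dj => /sd ->.
rewrite xE (fsbig_seq _ _ us); apply: fsbig_widen => //.
by move=> j [_ /= /negP /sd].
Qed.

Lemma componentE x (s : seq int) : uniq s ->
  (forall k, k \notin s -> component x k = 0) ->
  x = \sum_(k <- s) component x k.
Proof.
move=> us sx; have [r ur [rx xE]] := component_support x.
rewrite {1}xE (bigID (mem s))/= addrC big1 ?add0r; last first.
  by move=> k /sx.
rewrite [RHS](bigID (mem r))/= [X in _ = _ + X]big1 ?addr0; last first.
  by move=> k /rx.
rewrite -big_filter -[RHS]big_filter; apply: perm_big.
apply: uniq_perm; rewrite ?filter_uniq// => k.
by rewrite !mem_filter andbC.
Qed.

Lemma componentD x y k : component (x + y) k = component x k + component y k.
Proof.
have [s us [sx _]] := component_support x.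
have [r ur [ry _]] := component_support y.
pose u := undup (s ++ r).
have uP j : j \notin u -> component x j = 0 /\ component y j = 0.
  by rewrite mem_undup mem_cat negb_or => /andP[/sx -> /ry ->].
apply: (@component_uniq _ u (fun k => component x k + component y k) _ _ _ _ k).
- exact: undup_uniq.
- move=> j; have [/(_ j)[C0 CB] _ _] := dC.
  have CN : C j (- component y j).
    by rewrite -sub0r; apply: CB => //; exact: component_in.
  by rewrite -[component y j]opprK; apply: CB => //; exact: component_in.
- by move=> j /uP[-> ->]; rewrite addr0.
- rewrite big_split/= -!componentE ?undup_uniq//; by move=> j /uP[].
Qed.

Lemma component_homog x k j : C k x -> component x j = if j == k then x else 0.
Proof.
move=> Cx.
apply: (@component_uniq x [:: k] (fun i => if i == k then x else 0)) => // [i|i|].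
- by case: eqP => [->//|_]; have [/(_ i)[]] := dC.
- by rewrite inE => /negPf ->.
- by rewrite big_seq1 eqxx.
Qed.

Lemma component0 k : component 0 k = 0.
Proof.
by rewrite (@component_homog _ k) ?if_same//; have [/(_ k)[]] := dC.
Qed.

Lemma component_sum (I : Type) (s : seq I) (P : pred I) (F : I -> V) k :
  component (\sum_(i <- s | P i) F i) k = \sum_(i <- s | P i) component (F i) k.
Proof.
by apply: (big_morph (component^~ k) (fun x y => componentD x y k) (component0 k)).
Qed.

Lemma componentB x y k : component (x - y) k = component x k - component y k.
Proof. by apply/eqP; rewrite eq_sym subr_eq -componentD subrK. Qed.

(** The window is half-open, so length 0 leaves no degree at all; its length serves as induction
    parameter below. *)
Lemma component_window x : exists n (E : int),
  forall k, component x k != 0 -> E - n%:Z < k <= E.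
Proof.
have [s us [sx _]] := component_support x.
suff [n [E EP]] : exists n (E : int), forall k, k \in s -> E - n%:Z < k <= E.
  by exists n, E => k /negP nk; apply: EP; apply: contra_notT nk => /sx ->.
elim: s {us sx} => [|j s [n [E IH]]]; first by exists 0%N, 0.
exists (n + `|E - j| + `|E - j| + 1)%N, (E + `|E - j|%:Z) => k.
by rewrite inE => /orP[/eqP ->|/IH]; lia.
Qed.

End Component.

(** * Gradedness of associated primes *)

Section GradedModule.
Context {R : comPzRingType} {gR : ring_grading R} {N : lmodType R}
  (gN : mod_grading gR N).
Let cR := component (ring_comp_sum gR).
Let cN := component (mod_comp_sum gN).
Implicit Types (a b : R) (x y : N) (p : spec R).

Lemma mod_comp0 k : gN k 0.
Proof. by have [/(_ k)[]] := mod_comp_sum gN. Qed.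

Lemma componentZ d a x k : gR d a -> cN (a *: x) k = a *: cN x (k - d).
Proof.
move=> ga; have [s us [sx xE]] := component_support (mod_comp_sum gN) x.
apply: (@component_uniq _ _ _ (a *: x) [seq d + j | j <- s]
    (fun k => a *: cN x (k - d)) _ _ _ _ k).
- by rewrite map_inj_uniq//; exact: addrI.
- move=> j; rewrite -{1}[j](subrKC d).
  by apply: mod_compZ => //; exact: component_in.
- move=> j jP; rewrite /cN sx ?scaler0//; apply: contra jP => js.
  by apply/mapP; exists (j - d) => //; rewrite subrKC.
- rewrite big_map {1}xE scaler_sumr; apply: eq_bigr => j _.
  by rewrite addrC addKr.
Qed.

Lemma component_scale a x k (s : seq int) : uniq s ->
  (forall d, d \notin s -> cR a d = 0) ->
  cN (a *: x) k = \sum_(d <- s) cR a d *: cN x (k - d).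
Proof.
move=> us sa; rewrite {1}(componentE us sa) scaler_suml /cN component_sum.
by apply: eq_bigr => d _; apply: componentZ; exact: component_in.
Qed.

(* The component of [a] in its top degree [D] kills the component of [x] in its
   top degree [E], so multiplying by it shortens the degree window of [x]. *)
Lemma top_component_nilpotent a D :
  (forall d, D < d -> cR a d = 0) ->
  forall n E x, (forall e, cN x e != 0 -> E - n%:Z < e <= E) ->
  a *: x = 0 -> (cR a D) ^+ n *: x = 0.
Proof.
move=> aD; elim=> [|n IH] E x xP ax.
  rewrite scale1r [x](@componentE _ _ (mod_comp_sum gN) x [::]) ?big_nil//.
  by move=> k _; apply: contraTeq isT => /xP; lia.
(* In degree [D + E] of [a *: x], every summand but the product of the two tops has a factor above
   its top degree. Listing [D] first in [u] isolates that product even if [D] is not in [s]. *)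
have top0 : cR a D *: cN x E = 0.
  have [s us [sa _]] := component_support (ring_comp_sum gR) a.
  pose u := D :: rem D s.
  have uu : uniq u.
    by rewrite /= rem_uniq// andbT mem_rem_uniq// inE eqxx.
  have ua d : d \notin u -> cR a d = 0.
    rewrite inE negb_or mem_rem_uniq// inE negb_and => /andP[-> /= ds].
    exact: sa.
  have := component_scale x (D + E) uu ua.
  rewrite ax /cN component0 big_cons [D + E - D]addrAC subrr add0r.
  rewrite big1_seq ?addr0//.
  move=> d /andP[_]; rewrite mem_rem_uniq// inE => /andP[dD _].
  have [/aD ->|dD'] := ltP D d; first by rewrite scale0r.
  suff -> : component (mod_comp_sum gN) x (D + E - d) = 0 by rewrite scaler0.
  by apply: contraTeq isT => /xP; lia.
rewrite exprSr -scalerA; apply: (IH (D + E - 1)); last first.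
  by rewrite scalerA mulrC -scalerA ax scaler0.
move=> e; rewrite (@componentZ D); last exact: component_in.
move=> nz; have /xP : cN x (e - D) != 0.
  by apply: contraNneq nz => ->; rewrite scaler0.
have : e - D != E by apply: contraNneq nz => ->; rewrite top0.
lia.
Qed.

(** A power of the top component of [a] kills [x], so this component lies in the prime [p]; subtract
    it and induct on the window length. The element [x] itself need not be homogeneous. *)
Lemma Ass_graded p a d : Ass N p -> p a -> p (cR a d).
Proof.
move=> [x pE] pa.
have spec_expn b n : p (b ^+ n) -> p b.
  elim: n => [/spec_proper//|n IH]; rewrite exprS => /spec_prime[//|]; exact: IH.
have [n [D aP]] := component_window (ring_comp_sum gR) a.
elim: n a D pa aP => [|n IH] a D pa aP.
  suff -> : cR a d = 0 by exact: spec0.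
  by apply: contraTeq isT => /aP; lia.
have paD : p (cR a D).
  have [m [E xP]] := component_window (mod_comp_sum gN) x.
  apply: (spec_expn _ m); rewrite pE; apply: (top_component_nilpotent _ xP).
    by move=> e De; apply: contraTeq De => /aP; lia.
  by move: pa; rewrite pE.
have hom j : cR (cR a D) j = if j == D then cR a D else 0.
  by apply: component_homog; exact: component_in.
have : p (cR (a - cR a D) d).
  apply: (IH _ (D - 1)); first exact: specB.
  move=> k; rewrite componentB -/cR hom; case: (k =P D) => [->|kD].
    by rewrite subrr eqxx.
  by rewrite subr0 => /aP; lia.
rewrite /cR componentB -/cR hom => pad.
have := specD pad (_ : p (if d == D then cR a D else 0)); rewrite subrK; apply.
by case: eqP => // _; exact: spec0.
Qed.

End GradedModule.

(** * Homogeneous localization and socles *)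

(* [fraction.frac] would otherwise shadow the localization map. *)

Local Notation frac := Defs.frac.

(** Fraction-free Gaussian elimination: nonzero elements of the residue ring need not be units, so
    rows are multiplied by the pivot [u] instead of being divided by it. *)
Lemma integral_kernel_vector (K : comNzRingType) (r m : nat)
    (A : 'I_m -> 'I_r -> K) :
  (forall a b : K, a * b = 0 -> a = 0 \/ b = 0) -> (r < m)%N ->
  exists2 c : 'I_m -> K, exists i, c i <> 0 &
    forall j, \sum_i c i * A i j = 0.
Proof.
move=> dom; elim: r m A => [|r IH] [//|m] A rm.
  exists (fun=> 1); last by case.
  by exists ord0; apply/eqP; exact: oner_neq0.
have [[i0 Ai0]|A0] := pselect (exists i0, A i0 ord0 <> 0); last first.
  have [|c cnz cA] := IH m.+1 (fun i j => A i (lift ord0 j)); first exact: ltnW.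
  exists c => // j; case: (unliftP ord0 j) => [j' ->|->]; first exact: cA.
  apply: big1 => i _; have [->|nz] := eqVneq (A i ord0) 0; first by rewrite mulr0.
  by exfalso; apply: A0; exists i; apply/eqP.
set u := A i0 ord0 in Ai0.
have [//|c [i ci] cA] := IH m (fun i j =>
  u * A (lift i0 i) (lift ord0 j) - A (lift i0 i) ord0 * A i0 (lift ord0 j)).
pose e := \sum_i c i * A (lift i0 i) ord0.
exists (fun k => if unlift i0 k is Some i then u * c i else - e).
  by exists (lift i0 i); rewrite liftK => /dom[].
move=> j; rewrite (bigD1_ord i0)//= unlift_none.
under eq_bigr => k _ do rewrite liftK.
case: (unliftP ord0 j) => [j' ->|->].
  rewrite -[RHS](cA j') mulNr addrC mulr_suml -sumrB.
  by apply: eq_bigr => k _; ring.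
rewrite mulNr addrC; apply/eqP; rewrite subr_eq0 mulr_suml; apply/eqP.
by apply: eq_bigr => k _; rewrite -/u; ring.
Qed.

(** For elements killed by [p], this is linear independence over R / p. *)
Definition independent_mod (R : comPzRingType) (N : lmodType R) (p : spec R)
    (I : finType) (x : I -> N) :=
  forall d : I -> R, \sum_i d i *: x i = 0 -> forall i, p (d i).

Section Localization.
Variables (R : comPzRingType) (S : mulset R).

Lemma frac_eq0P (V : lmodType R) (x : V) (s : denom S) :
  frac x s = 0 <-> exists u : denom S, dval u *: x = 0.
Proof.
rewrite frac_eqP; split=> -[u]; rewrite dval1 scale1r ?scaler0; exists u => //.
by rewrite !scaler0.
Qed.

Lemma frac_fixed_denomD (V : lmodType R) (x y : V) (s : denom S) :
  frac x s + frac y s = frac (x + y) s.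
Proof. by rewrite fracD -scalerDr; apply: frac_eq; rewrite dvalM scalerA. Qed.

Lemma frac0 (V : lmodType R) (s : denom S) : frac (0 : V) s = 0.
Proof. by apply/frac_eq0P; exists s; rewrite scaler0. Qed.

Lemma frac_sum (V : lmodType R) (I : Type) (r : seq I) (F : I -> V)
    (s : denom S) :
  \sum_(i <- r) frac (F i) s = frac (\sum_(i <- r) F i) s.
Proof.
elim: r => [|i r IH]; first by rewrite !big_nil frac0.
by rewrite !big_cons IH frac_fixed_denomD.
Qed.

Lemma common_denominator (I : eqType) (r : seq I) (c : I -> locring S) :
  exists (s : denom S) (d : I -> R), forall i, i \in r -> c i = fracr (d i) s.
Proof.
elim: r => [|i r [s [d IH]]]; first by exists (denom1 S), (fun=> 0).
have : exists a t, c i = fracr a t.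
  by elim/(@fracrW _ S): (c i) => a t; exists a, t.
move=> [a [t ct]].
exists (denomM s t), (fun j => if j == i then dval s * a else dval t * d j).
move=> j; rewrite inE; case: eqP => [-> _|_ /= /IH ->].
  by rewrite ct; apply: fracr_eq; rewrite dvalM; ring.
by apply: fracr_eq; rewrite dvalM; ring.
Qed.
End Localization.

Section Socle.
Context {R : comPzRingType} (gR : ring_grading R) {N : lmodType R}
  (p : spec R).
Local Notation S := (homog_mulset gR p).
Local Notation K := (residue_hlocring gR p).
Local Notation J := (@hlocideal R gR p).
Implicit Types (s t u : denom S).

Lemma denom_notin_spec s : ~ p (dval s).
Proof. by case: (denomP s). Qed.

Lemma hlocidealE a s : ((fracr a s : hlocring gR p) \in J) <-> p a.
Proof.
split=> [/asboolP[b [t [pb]]] /frac_eqP[u e]|pa]; last first.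
  by apply/asboolP; exists a, s.
have {}e : dval u * (dval t * a) = dval u * (dval s * b) := e.
have : p (dval u * (dval t * a)) by rewrite e; do 2!apply: specM.
by case/spec_prime => [/denom_notin_spec//|/spec_prime[/denom_notin_spec//|]].
Qed.

Lemma qproj_eq0 (c : hlocring gR p) :
  qproj J c = 0 <-> c \in J.
Proof.
have -> : 0 = qproj J 0 by rewrite /qproj piE.
rewrite -{2}[c]subr0 Quotient.idealrBE; split=> [e|/eqP//].
exact/eqP.
Qed.

Lemma residue_hlocring_integral (a b : K) : a * b = 0 -> a = 0 \/ b = 0.
Proof.
elim/(@qprojW _ J): a => a.
elim/(@qprojW _ J): b => b.
rewrite qprojM !qproj_eq0.
elim/(@fracrW _ S): a => a s; elim/(@fracrW _ S): b => b t.
by rewrite [_ * _]fracrM !hlocidealE => /spec_prime.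
Qed.

Definition killed_by (x : N) := forall a, p a -> a *: x = 0.

Lemma frac_killed (x : N) s : killed_by x ->
  (frac x s : hlocmod gR p N) \in @killed _ J (hlocmod gR p N).
Proof.
move=> px; apply/asboolP; elim/(@fracrW _ S) => a t /hlocidealE pa.
by rewrite [_ *: _]fracZ px// frac0.
Qed.

Definition soc_elt (x : N) (px : killed_by x) : hloc_socle gR p N :=
  Socle (frac_killed (denom1 S) px).

Lemma socle_val_sum (I : Type) (r : seq I) (F : I -> hloc_socle gR p N) :
  socle_val (\sum_(i <- r) F i) = \sum_(i <- r) socle_val (F i).
Proof. exact: (big_morph _ (@socle_valD _ _ _) (erefl _)). Qed.

Lemma soc_elt_combination (I : finType) (x : I -> N)
    (px : forall i, killed_by (x i)) (d : I -> R) s :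
  socle_val (\sum_i (qproj J (fracr (d i) s) : K) *:
    soc_elt (px i)) = frac (\sum_i d i *: x i) s.
Proof.
rewrite socle_val_sum -frac_sum; apply: eq_bigr => i _.
rewrite [LHS]socle_scaleE [LHS]fracZ; apply: frac_eq.
by rewrite dvalM dval1 mulr1.
Qed.

Lemma fracr_representatives (I : finType) (c : I -> K) :
  exists s d, c = fun i => qproj J (fracr (d i) s).
Proof.
have /choice[b bP] : forall i, exists b, c i = qproj J b.
  by move=> i; elim/(@qprojW _ J): (c i) => b; exists b.
have [s [d dP]] := @common_denominator _ S _ (enum I) b.
by exists s, d; apply/funext => i; rewrite bP dP// mem_enum.
Qed.

(** After clearing denominators, a relation holds in [N] up to a factor [u] outside [p], and the
    prime [p] allows [u] to be cancelled. *)
Lemma soc_elt_independent (I : finType) (x : I -> N)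
    (px : forall i, killed_by (x i)) : independent_mod p x ->
  forall c : I -> K, \sum_i c i *: soc_elt (px i) = 0 -> forall i, c i = 0.
Proof.
move=> ind c; have [s [d ->]] := fracr_representatives c.
move=> /(congr1 (@socle_val _ _ _)); rewrite soc_elt_combination.
move=> /frac_eq0P[u]; rewrite scaler_sumr => e i.
apply/qproj_eq0/hlocidealE.
have /spec_prime[/denom_notin_spec|] // : p (dval u * d i).
apply: (ind (fun i => dval u * d i)); rewrite -[RHS]e.
by apply: eq_bigr => j _; rewrite scalerA.
Qed.

End Socle.

(** * Freeness and rank of the socle *)

Section SocleRank.
Context {R : comPzRingType} {gR : ring_grading R} {N : lmodType R}
  (gN : mod_grading gR N) {p : spec R}.
Hypotheses (noeth : noetherian N) (assp : Ass N p).
Local Notation S := (homog_mulset gR p).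
Local Notation K := (residue_hlocring gR p).
Local Notation J := (@hlocideal R gR p).
Let cR := component (ring_comp_sum gR).
Let cN := component (mod_comp_sum gN).

Definition span m (y : 'I_m -> N) : set N :=
  [set x | exists a : 'I_m -> R, x = \sum_i a i *: y i].

Lemma is_submodule_span m (y : 'I_m -> N) : is_submodule (span y).
Proof.
split; first by exists (fun=> 0); rewrite big1// => i _; rewrite scale0r.
move=> a _ _ [b ->] [c ->]; exists (fun i => a * b i + c i).
rewrite scaler_sumr -big_split; apply: eq_bigr => i _ /=.
by rewrite scalerDl scalerA.
Qed.

(** As [p] is graded, each homogeneous component of an element of [p] kills [x], hence each
    component of [x]. *)
Lemma killed_by_component x k : killed_by p x -> killed_by p (cN x k).
Proof.
move=> px a pa; have [s us [sa _]] := component_support (ring_comp_sum gR) a.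
rewrite (componentE us sa) scaler_suml; apply: big1_seq => d _.
rewrite -[k](addrK d) -componentZ; last exact: component_in.
by rewrite px /cN ?component0//; exact: (Ass_graded gN).
Qed.

Lemma component_scale_homog a x e k : gN e x ->
  cN (a *: x) k = cR a (k - e) *: x.
Proof.
move=> gx; have [s us [sa _]] := component_support (ring_comp_sum gR) a.
rewrite /cN (component_scale gN x k us sa).
have xE j : component (mod_comp_sum gN) x j = if j == e then x else 0.
  exact: component_homog.
have [ks|ks] := boolP (k - e \in s).
  rewrite (bigD1_seq (k - e))//= big1 ?addr0; last first.
    move=> d dk; rewrite xE; case: (k - d =P e) dk => [|_ _]; last by rewrite scaler0.
    by move=> <-; rewrite subKr eqxx.
  by rewrite xE subKr eqxx.
rewrite /cR sa// scale0r big1_seq// => d /andP[_ ds].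
rewrite xE; case: (k - d =P e) ks => [<-|_ _]; last by rewrite scaler0.
by rewrite subKr ds.
Qed.

(** If the coefficient of [x] in a relation is outside [p], so is one of its components. The
    corresponding component of the relation then puts a homogeneous multiple of [x], with factor
    outside [p], in the span. *)
Lemma homog_coordinates m (y : 'I_m -> N) (x : N) e (deg : 'I_m -> int) :
  (forall i, gN (deg i) (y i)) -> gN e x -> killed_by p x ->
  independent_mod p y ->
  ~ (exists (s : denom S), span y (dval s *: x)) ->
  independent_mod p (fun i => if unlift ord0 i is Some j then y j else x).
Proof.
move=> gy gx px ind nos d.
rewrite big_ord_recl unlift_none.
under eq_bigr => i _ do rewrite liftK.
move=> d0; suff pd0 : p (d ord0).
  move=> i; case: (unliftP ord0 i) => [j ->|->//].
  apply: (ind (fun j => d (lift ord0 j))).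
  by rewrite px// add0r in d0.
apply: contrapT => npd.
have [k npk] : exists k, ~ p (cR (d ord0) k).
  apply: contrapT => allp; apply: npd.
  have [s us [_ ->]] := component_support (ring_comp_sum gR) (d ord0).
  apply: big_ind; [exact: spec0|by move=> ? ?; exact: specD|].
  by move=> k _; apply: contrapT => npk; apply: allp; exists k.
apply: nos; have Sk : S (cR (d ord0) k).
  by split => //; exists k; exact: component_in.
(* These are the coefficients in the degree [k + e] component of the relation, solved for [x]. *)
exists (Denom Sk), (fun i => - cR (d (lift ord0 i)) (k + e - deg i)).
have := congr1 (fun z => cN z (k + e)) d0.
rewrite /= /cN componentD component_sum component0.
rewrite -/cN (component_scale_homog _ _ gx) addrK.
move/eqP; rewrite addr_eq0 => /eqP e0; rewrite [LHS]e0 -sumrN.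
by apply: eq_bigr => i _; rewrite scaleNr; congr (- _); exact: component_scale_homog.
Qed.

(** Maximality is imposed on the span, a submodule of [N], so no bound on the size of the family is
    needed in advance. Elements that are not homogeneous are treated component by component. *)
Lemma maximal_homog_independent : exists m (y : 'I_m -> N),
  [/\ forall i, killed_by p (y i), independent_mod p y &
      forall x, killed_by p x -> exists s : denom S, span y (dval s *: x)].
Proof.
pose P := [set W | exists m (y : 'I_m -> N) deg,
  [/\ forall i, gN (deg i) (y i), forall i, killed_by p (y i),
      independent_mod p y & W = span y]].
have [||_ [m [y [deg [gy py ind ->]]]] ymax] := @noetherian_max _ _ P noeth.
- by move=> _ [m [y [_ [_ _ _ ->]]]]; exact: is_submodule_span.
- exists (@span 0 (fun=> 0)), 0%N, (fun=> 0), (fun=> 0); split => //.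
  + by case.
  + by case.
  + by move=> d _ [].
exists m, y; split => // x px.
have homog e z : gN e z -> killed_by p z -> exists s : denom S, span y (dval s *: z).
  (* By [nos], adjoining [z] keeps the family independent, so maximality puts [z] itself in the old
     span, contradicting [nos] with denominator 1. *)
  move=> gz pz; apply: contrapT => nos; apply: (nos).
  pose y' i := if unlift ord0 i is Some j then y j else z.
  exists (denom1 _); rewrite dval1 scale1r; apply: (ymax (span y')).
  - exists m.+1, y', (fun i => if unlift ord0 i is Some j then deg j else e).
    split => //.
    + by move=> i; rewrite /y'; case: (unlift ord0 i).
    + by move=> i; rewrite /y'; case: (unlift ord0 i).
    + exact: (homog_coordinates gy gz).
  - move=> w [a ->]; exists (fun i => if unlift ord0 i is Some j then a j else 0).
    rewrite big_ord_recl unlift_none scale0r add0r.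
    by apply: eq_bigr => i _; rewrite /y' liftK.
  - exists (fun i => (i == ord0)%:R).
    rewrite big_ord_recl eqxx scale1r /y' unlift_none big1 ?addr0// => i _.
    by rewrite scale0r.
have [s us [_ ->]] := component_support (mod_comp_sum gN) x.
elim/big_ind: _ => [|a b [t ta] [u ub]|k _].
- by exists (denom1 _); rewrite scaler0; case: (is_submodule_span y).
- exists (denomM t u).
  rewrite dvalM scalerDr; apply: is_submoduleD; first exact: is_submodule_span.
    by rewrite mulrC -scalerA; apply: is_submoduleZ => //; exact: is_submodule_span.
  by rewrite -scalerA; apply: is_submoduleZ => //; exact: is_submodule_span.
- apply: (homog k); first exact: component_in.
  exact: killed_by_component.
Qed.

(** The submodule p z is finitely generated and each generator is killed by some denominator;
    multiplying [z] by the product of these denominators makes it killed by [p]. *)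
Lemma socle_killed_numerator (v : hloc_socle gR p N) :
  exists (x : N) (s : denom S),
    killed_by p x /\ socle_val v = frac x s.
Proof.
have : exists z s, socle_val v = frac z s.
  by elim/(@fracW _ S): (socle_val v) => z s; exists z, s.
move=> [z [s vE]].
pose W := [set y | exists2 a, p a & y = a *: z].
have [|n [b Wb]] := noeth (W := W).
  split; first by exists 0; rewrite ?scale0r//; exact: spec0.
  move=> a _ _ [c pc ->] [d pd ->]; exists (a * c + d).
    by apply: specD => //; exact: specM.
  by rewrite scalerDl scalerA.
have /choice[t tP] : forall k, exists t : denom S, dval t *: b k = 0.
  move=> k; have [a pa ->] : W (b k).
    rewrite Wb /=; exists (fun j => (j == k)%:R).
    rewrite (bigD1 k)//= eqxx scale1r big1 ?addr0// => j /negPf ->.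
    by rewrite scale0r.
  have /asboolP/(_ (fracr a (denom1 S))) := valP v.
  rewrite -[val v]/(socle_val v) vE [_ *: _]fracZ.
  by move=> /(_ ((hlocidealE _ _).2 pa))/frac_eq0P.
have St : S (\prod_k dval (t k)).
  by elim/big_ind: _ => [|? ?|k _]; [exact: mulset1|exact: mulsetM|exact: denomP].
exists (dval (Denom St) *: z), (denomM (Denom St) s); split; last first.
  by rewrite vE; apply: frac_eq; rewrite dvalM scalerA mulrC.
move=> a pa; have : W (a *: z) by exists a.
rewrite scalerA mulrC -scalerA Wb => -[c ->].
rewrite scaler_sumr; apply: big1 => k _.
rewrite scalerA mulrC -scalerA [dval _](bigD1 k)//=.
by rewrite [_ * _]mulrC -scalerA tP !scaler0.
Qed.

(** A maximal homogeneous independent family spans up to denominators, which are invertible in the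
    localization. Since [rank] defaults to 0, the bound by [socle_rank] below rests on this
    existence. *)
Lemma socle_basis_exists : exists m (b : 'I_m -> hloc_socle gR p N), is_basis b.
Proof.
have [m [y [py ind ymax]]] := maximal_homog_independent.
exists m, (fun i => soc_elt gR (py i)) => v.
have [x [s [px vE]]] := socle_killed_numerator v.
have [t [a ta]] := ymax x px.
exists (fun i => qproj J (fracr (a i) (denomM t s))); split.
  apply: val_inj; rewrite -![val _]/(socle_val _) soc_elt_combination -ta vE.
  by apply: frac_eq; rewrite dvalM scalerA mulrC.
move=> c vc; apply/funext => i; apply/eqP; rewrite -subr_eq0; apply/eqP; move: i.
apply: (soc_elt_independent (px := py) ind).
under eq_bigr => i _ do rewrite scalerBl.
rewrite sumrB; apply/eqP; rewrite subr_eq0; apply/eqP; rewrite -vc.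
apply: val_inj; rewrite -![val _]/(socle_val _) soc_elt_combination -ta vE.
by apply: frac_eq; rewrite dvalM scalerA mulrC.
Qed.

Lemma independent_le_socle_rank m (x : 'I_m -> N) :
  (forall i, killed_by p (x i)) -> independent_mod p x ->
  (m <= socle_rank gR N p)%N.
Proof.
move=> px ind; rewrite leqNgt; apply/negP => rm.
have [b bP] : [set n | exists b : 'I_n -> hloc_socle gR p N, is_basis b]
    (socle_rank gR N p) by apply: xgetPex; exact: socle_basis_exists.
have /choice[A AP] : forall i, exists a, soc_elt gR (px i) = \sum_k a k *: b k.
  by move=> i; have [a [aE _]] := bP (soc_elt gR (px i)); exists a.
have [c [i ci] cA] := integral_kernel_vector A (@residue_hlocring_integral _ gR p) rm.
apply: ci; apply: (soc_elt_independent (px := px) ind).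
under eq_bigr => j _ do rewrite AP scaler_sumr.
rewrite exchange_big; apply: big1 => k _ /=.
under eq_bigr => j _ do rewrite scalerA.
by rewrite -scaler_suml cA scale0r.
Qed.
End SocleRank.

(** * Pencils of homomorphisms *)

Section Good.
Context {R : comPzRingType} {N M : lmodType R}.
Implicit Types (p q : spec R) (f g : {linear N -> M}) (x y : N).

(* Injectivity of [f] on [Soc N_(p)], tested on the elements of [N] with
   annihilator exactly [p]. *)
Definition good f p :=
  forall x, (p : set R) = annihilator x -> f x <> 0.

Lemma good_everywhere_injective f : noetherian N ->
  (forall p, Ass N p -> good f p) -> injective f.
Proof.
move=> noeth fgood x y fxy; apply/eqP; rewrite -subr_eq0; apply/eqP.
apply: contrapT => nz.
have [||p assp [z fz pz]] := @exists_Ass_in _ _ [set z | f z = 0] noeth.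
- split; first exact: linear0.
  by move=> a u v /= u0 v0; rewrite linearP u0 v0 scaler0 addr0.
- by exists (x - y) => //=; rewrite linearB fxy subrr.
- exact: (fgood _ assp _ pz fz).
Qed.

Lemma hloc_injective_good (gR : ring_grading R) f p :
  injective (hloc_map gR p f) -> good f p.
Proof.
move=> finj x px fx0.
have : frac x (denom1 (homog_mulset gR p)) = 0.
  apply: finj; rewrite -[0 in RHS](frac0 N (denom1 _)) /hloc_map !loc_mapE.
  by rewrite fx0 linear0.
by move=> /frac_eq0P[u ux]; have := @denom_notin_spec _ gR p u; rewrite px.
Qed.

Lemma killed_by_annihilator p x : (p : set R) = annihilator x -> killed_by p x.
Proof. by move=> px a; rewrite px. Qed.

(** The annihilator of [y] contains [p], and goodness forbids equality. *)
Lemma good_torsion f p y : good f p -> killed_by p y -> f y = 0 ->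
  exists2 t, ~ p t & t *: y = 0.
Proof.
move=> fgood py fy0; apply: contrapT => not.
apply: (fgood y) fy0; apply/seteqP; split; first exact: py.
by move=> t ty; apply: contrapT => npt; apply: not; exists t.
Qed.

(* The [x i] are eigenvectors for the pairwise distinct eigenvalues [- a i] of
   the pencil [f, g]. *)
Lemma pencil_independent p f g (I : finType) (x : I -> N) (a : I -> R) :
  (forall i, (p : set R) = annihilator (x i)) ->
  (forall i, f (x i) + a i *: g (x i) = 0) ->
  (forall i j, i != j -> ~ p (a i - a j)) ->
  good f p \/ good g p -> independent_mod p x.
Proof.
move=> px fg aij fg_good d0 d0x i0.
suff : forall (s : seq I) (d : I -> R), uniq s -> \sum_(i <- s) d i *: x i = 0 ->
    forall i, i \in s -> p (d i).
  by move/(_ (index_enum I) d0 (index_enum_uniq I)); apply;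
    rewrite ?mem_index_enum.
elim=> [//|k s IH] d /= /andP[ks us]; rewrite big_cons => dx.
have fE i : f (x i) = - (a i *: g (x i)) by apply/eqP; rewrite -addr_eq0 fg.
(* Apply [f] and [a k *: g] to the relation and add: since [f (x i) = - (a i *: g (x i))], the term
   of [k] cancels. *)
have sub0 : \sum_(i <- s) (d i * (a i - a k)) *: g (x i) = 0.
  have gdx := congr1 g dx; have fdx := congr1 f dx.
  rewrite linear0 linearD linear_sum in gdx.
  rewrite linear0 linearD linear_sum in fdx.
  have {}fdx : (d k * a k) *: g (x k) + \sum_(i <- s) (d i * a i) *: g (x i) = 0.
    apply: oppr_inj; rewrite oppr0 -[RHS]fdx opprD (linearZZ f) fE scalerN scalerA.
    congr (_ + _); rewrite -sumrN; apply: eq_bigr => i _.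
    by rewrite (linearZZ f) fE scalerN scalerA.
  have {}gdx : (d k * a k) *: g (x k) + \sum_(i <- s) (d i * a k) *: g (x i) = 0.
    rewrite -[RHS](scaler0 _ (a k)) -[X in _ = _ *: X]gdx.
    rewrite scalerDr (linearZZ g) scalerA mulrC.
    congr (_ + _); rewrite scaler_sumr; apply: eq_bigr => i _.
    by rewrite (linearZZ g) scalerA mulrC.
  have e := congr2 (fun u v => u - v) fdx gdx; rewrite /= subr0 in e.
  rewrite -[RHS]e opprD addrACA subrr add0r -sumrB.
  by apply: eq_bigr => i _; rewrite -scalerBl mulrBr.
(* Pull [sub0] back along the map that is good at [p]. For [g] this is immediate. For [f], no [a i]
   is in [p], and with [e i] the product of the other [a j], the image under [f] is a common
   multiple of [sub0]. *)
have [e ne [t nt ty]] : exists2 e : I -> R, (forall i, i \in s -> ~ p (e i)) &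
    exists2 t, ~ p t & t *: \sum_(i <- s) (e i * d i * (a i - a k)) *: x i = 0.
  have killed_sum (e : I -> R) : killed_by p (\sum_(i <- s) e i *: x i).
    move=> b pb; rewrite scaler_sumr; apply: big1 => i _.
    by rewrite scalerA mulrC -scalerA (killed_by_annihilator (px i) pb) scaler0.
  case: fg_good => h_good; last first.
    exists (fun=> 1); first by move=> *; exact: spec_proper.
    apply: good_torsion h_good _ _; first exact: killed_sum.
    rewrite linear_sum -[RHS]sub0; apply: eq_bigr => i _.
    by rewrite (linearZZ g) mul1r.
  have na i : ~ p (a i).
    move=> pa; apply: h_good (px i) _.
    rewrite fE -(linearZZ g) (killed_by_annihilator (px i) pa).
    by rewrite linear0 oppr0.
  exists (fun i => \prod_(j <- s | j != i) a j).
    by move=> i _; exact: spec_prod.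
  apply: good_torsion h_good _ _; first exact: killed_sum.
  rewrite linear_sum -[RHS](scaler0 _ (- \prod_(j <- s) a j)).
  rewrite -[X in _ = _ *: X]sub0 scaler_sumr.
  apply: eq_big_seq => i si; rewrite (linearZZ f) fE scalerN -scaleNr !scalerA.
  by congr (_ *: _); rewrite (bigD1_seq i)//=; ring.
have ps i : i \in s -> p (d i).
  move=> si; have : p (t * (e i * d i * (a i - a k))).
    apply: (IH (fun i => t * (e i * d i * (a i - a k)))) => //.
    rewrite -[RHS]ty scaler_sumr; apply: eq_bigr => j _.
    by rewrite scalerA.
  have ik : i != k by apply: contraNneq ks => <-.
  case/spec_prime => // /spec_prime[/spec_prime[/(ne _ si)//|//]|].
  by move/(aij _ _ ik).
move=> i; rewrite inE => /orP[/eqP ->|/ps//].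
rewrite (px k); rewrite big1_seq ?addr0// in dx.
by move=> j /= /ps; rewrite (px j).
Qed.
End Good.

(** * Degree 0 parts of primes *)

Section Degree0.
Context {R : comPzRingType} {gR : ring_grading R}.
Implicit Types (p q : spec R).

Lemma ring_comp_mul0 a b k : gR 0 a -> gR k b -> gR k (a * b).
Proof. by move=> ga gb; rewrite -[k]add0r; exact: ring_compM. Qed.

Lemma ring_compB k a b : gR k a -> gR k b -> gR k (a - b).
Proof. by have [/(_ k)[_ +] _ _] := ring_comp_sum gR; apply. Qed.

Lemma incongruent_residues n p : ~~ (residue0 gR p #<= `I_n) ->
  exists c : 'I_n.+1 -> R,
    (forall k, gR 0 (c k)) /\ forall j k, j != k -> ~ p (c j - c k).
Proof.
move=> large.
have : `I_n.+1 #<= residue0 gR p.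
  have [/finite_setP[m em]|/infiniteP inf] := pselect (finite_set (residue0 gR p)).
    move: large; rewrite (card_le_eql em) (card_le_eqr em) !card_le_II.
    by rewrite -ltnNge.
  by apply: card_le_trans inf; exact: card_leT.
case/pcard_leP => h.
have /choice[c cP] : forall k : 'I_n.+1, exists a, gR 0 a /\
    [set a + b | b in spec_comp0 gR p] = h k.
  move=> k; have [a ga ah] : residue0 gR p (h k) by apply: funS => /=.
  by exists a.
exists c; split=> [k|j k jk pjk]; first by case: (cP k).
case/eqP: jk; apply/val_inj; apply: (@inj _ _ _ h); rewrite ?inE//=.
rewrite -(cP j).2 -(cP k).2; have [gj _] := cP j; have [gk _] := cP k.
have sub u v : gR 0 u -> gR 0 v -> p (u - v) ->
    [set u + b | b in spec_comp0 gR p] `<=` [set v + b | b in spec_comp0 gR p].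
  move=> gu gv puv _ [b [pb gb] <-]; exists (u - v + b); last by rewrite addrA subrKC.
  split; first exact: specD.
  rewrite -[b]opprK; apply: ring_compB; first exact: ring_compB.
  by rewrite -sub0r; apply: ring_compB => //; exact: ring_comp0.
apply/seteqP; split; apply: sub => //.
by rewrite -opprB -mulN1r; exact: specM.
Qed.

(** Take the product of one element of each [q] of degree 0 outside [p]; it stays outside [p] by
    primality. *)
Lemma comp0_avoidance p (s : seq (spec R)) :
  (forall q, q \in s -> ~ spec_comp0 gR q `<=` spec_comp0 gR p) ->
  exists b, [/\ gR 0 b, ~ p b & forall q, q \in s -> q b].
Proof.
elim: s => [_|q s IH qs].
  by exists 1; split => //; [exact: ring_comp1|exact: spec_proper].
have [|b [gb npb sb]] := IH.
  by move=> r rs; apply: qs; rewrite inE rs orbT.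
have [a [[qa ga] npa]] : exists a, spec_comp0 gR q a /\ ~ spec_comp0 gR p a.
  apply: contrapT => noa; apply: (qs q); first by rewrite inE eqxx.
  by move=> a qa; apply: contrapT => npa; apply: noa; exists a.
exists (a * b); split.
- exact: ring_comp_mul0.
- by case/spec_prime => [pa|//]; case: npa.
- move=> r; rewrite inE => /orP[/eqP ->|/sb]; last exact: specM.
  by rewrite mulrC; exact: specM.
Qed.

Lemma maximal_comp0 (s : seq (spec R)) : s != [::] ->
  exists2 p, p \in s & forall q, q \in s ->
    spec_comp0 gR p `<=` spec_comp0 gR q -> spec_comp0 gR q `<=` spec_comp0 gR p.
Proof.
elim: s => // r [|r' s] IH _.
  by exists r; rewrite ?inE// => q; rewrite inE => /eqP ->.
have [//|p ps pmax] := IH.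
have [pr|npr] := pselect (spec_comp0 gR p `<=` spec_comp0 gR r); last first.
  exists p; first by rewrite inE ps orbT.
  by move=> q; rewrite inE => /orP[/eqP ->|/pmax].
exists r; first by rewrite inE eqxx.
move=> q; rewrite inE => /orP[/eqP ->//|/pmax qp] rq.
exact: subset_trans (qp (subset_trans pr rq)) pr.
Qed.
End Degree0.

(** * Correcting a map one prime at a time *)

Section Extension.
Context {R : comPzRingType} {gR : ring_grading R} {M N : lmodType R}
  (gM : mod_grading gR M) (gN : mod_grading gR N).
Hypothesis noeth : noetherian N.
Implicit Types (p q : spec R) (f g : Hommod N M) (A : seq (spec R)).

Lemma degree_component_hom i a f g : hom_comp gN gM i f -> gR 0 a ->
  hom_comp gN gM i g -> hom_comp gN gM i (f + a *: g).
Proof.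
move=> fi ga gi j x gx; have [/(_ (i + j))[C0 CB] _ _] := mod_comp_sum gM.
have ag : gM (i + j) (a *: g x).
  by rewrite -[i + j]add0r; apply: mod_compZ => //; exact: gi.
have -> : (f + a *: g : {linear N -> M}) x = f x - (0 - a *: g x).
  by rewrite sub0r opprK.
by apply: (CB _ _ (fi j x gx)); exact: CB.
Qed.

(** Pigeonhole: if all [n.+1] multipliers [b * c k] failed, each would fail at some prime with the
    degree 0 part of [p], while each such [q] accounts for at most [socle_rank gR N q] failures, and
    these ranks add up to [n]. *)
Lemma extend_good A p f g :
  (forall q, q \in A -> good f q) -> good g p ->
  (forall q, q \in A -> spec_comp0 gR q `<=` spec_comp0 gR p ->
    spec_comp0 gR p `<=` spec_comp0 gR q) ->
  ~~ (residue0 gR p #<=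
        `I_(\sum_(q \in same_degree0 gR N p) socle_rank gR N q)) ->
  exists2 a, gR 0 a & forall q, q \in p :: A -> good (f + a *: g) q.
Proof.
move=> fA gp Amax; set n := (X in `I_X) => large.
pose E := [seq q <- A | ~~ `[< spec_comp0 gR q = spec_comp0 gR p >]].
have [|b [gb npb Eb]] := @comp0_avoidance _ gR p E.
  move=> q; rewrite mem_filter => /andP[/asboolPn neq qA] qp; apply: neq.
  by apply/seteqP; split => //; exact: Amax.
have [c [gc cP]] := incongruent_residues large.
apply: contrapT => bad.
have /choice[u uP] : forall k, exists u : spec R * N,
    [/\ u.1 \in p :: A, (u.1 : set R) = annihilator u.2 &
        f u.2 + (b * c k) *: g u.2 = 0].
  move=> k; apply: contrapT => nou; apply: bad; exists (b * c k).
    exact: ring_comp_mul0.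
  by move=> q qA x qx fx; apply: nou; exists (q, x).
have assu k : Ass N (u k).1 by exists (u k).2; have [] := uP k.
(* At a treated prime with another degree 0 part, [b] kills the element, so the correction vanishes
   there and [f] alone would kill it. *)
have uD k : same_degree0 gR N p (u k).1.
  split => //; apply: contrapT => neq; have [+ ux fgx] := uP k.
  rewrite inE => /orP[/eqP up|uA]; first by apply: neq; rewrite up.
  have ub : (u k).1 b.
    by apply: Eb; rewrite mem_filter uA andbT; apply/asboolPn.
  apply: (fA _ uA _ ux); move: fgx; rewrite mulrC -scalerA.
  by rewrite -(linearZZ g) (killed_by_annihilator ux ub) linear0 scaler0 addr0.
have finD : finite_set (same_degree0 gR N p).
  by apply: sub_finite_set (finite_Ass noeth) => q [].
pose D := fset_set (same_degree0 gR N p).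
have count_le q : (#|[set k | (u k).1 == q]%SET| <= socle_rank gR N q)%N.
  set K := finset _; have [->|[k0]] := set_0Vmem K; first by rewrite cards0.
  rewrite inE => /eqP uk0.
  have KE (j : 'I_#|K|) : (u (enum_val j)).1 = q.
    by have := enum_valP j; rewrite inE => /eqP.
  have qx j : (q : set R) = annihilator (u (@enum_val _ (mem K) j)).2.
    by rewrite -(KE j); have [] := uP (enum_val j).
  have [_ q0] := uD k0; rewrite uk0 in q0.
  have qp a : gR 0 a -> q a -> p a.
    move=> ga qa; have : spec_comp0 gR q a by [].
    by rewrite q0 => -[].
  apply: (independent_le_socle_rank gN noeth _ (x := fun j => (u (enum_val j)).2)).
  - by rewrite -uk0.
  - by move=> j; apply: killed_by_annihilator; exact: qx.
  - apply: (@pencil_independent _ _ _ q f g _ _ (fun j => b * c (enum_val j))) => //.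
    + by move=> j; have [] := uP (enum_val j).
    (* Both [b] and the differences of the [c k] have degree 0 and lie outside [p], hence outside
       [q], which has the same degree 0 part. *)
    + move=> j k jk; rewrite -mulrBr => /spec_prime[/(qp _ gb)//|].
      move/qp => /(_ (ring_compB (gc _) (gc _))).
      by apply: cP; rewrite (inj_eq enum_val_inj).
    (* The good member of the pencil is [g] at [p] and [f] at the primes of [A]. *)
    + have [+ _ _] := uP k0; rewrite uk0 inE => /orP[/eqP ->|/fA]; first by right.
      by left.
have : (n < n)%N; last by rewrite ltnn.
rewrite {2}/n fsbig_finite// -/D.
have count_sum := @leq_sum _ D xpredT _ _ (fun q _ => count_le q).
apply: leq_trans count_sum.
have -> : (\sum_(q <- D) #|[set k | (u k).1 == q]%SET| =
    \sum_(k < n.+1) \sum_(q <- D) ((u k).1 == q))%N.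
  rewrite exchange_big; apply: eq_bigr => q _ /=.
  by rewrite -sum1dep_card big_mkcond.
rewrite -[X in (X <= _)%N](card_ord n.+1) -sum1_card; apply: leq_sum => k _.
have uk : (u k).1 \in D by rewrite in_fset_set// inE.
by rewrite (bigD1_seq _ uk (fset_uniq _))/= eqxx.
Qed.

(** [T] lists the untreated primes. The invariant says that no treated prime has its degree 0 part
    strictly inside that of an untreated one; treating a prime of [T] with maximal degree 0 part
    preserves it. *)
Lemma exists_good_everywhere (F : set (Hommod N M)) i (s T : seq (spec R)) :
  is_submodule F ->
  (forall p, p \in s -> ~~ (residue0 gR p #<=
        `I_(\sum_(q \in same_degree0 gR N p) socle_rank gR N q))) ->
  (forall p, p \in s -> exists g, [/\ F g, hom_comp gN gM i g & good g p]) ->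
  uniq T -> {subset T <= s} ->
  (forall q p, q \in s -> q \notin T -> p \in T ->
    spec_comp0 gR q `<=` spec_comp0 gR p ->
    spec_comp0 gR p `<=` spec_comp0 gR q) ->
  (exists f, [/\ F f, hom_comp gN gM i f &
    forall q, q \in s -> q \notin T -> good f q]) ->
  exists f, [/\ F f, hom_comp gN gM i f & forall q, q \in s -> good f q].
Proof.
move=> sF large loc; move: {2}(size T) (leqnn (size T)) => n.
elim: n T => [|n IH] T sT uT Ts Tmax [f [Ff fi fT]].
  exists f; split => // q qs; apply: fT => //.
  by move: sT; rewrite leqn0 size_eq0 => /eqP ->.
have [T0|T0] := eqVneq T [::].
  by exists f; split => // q qs; apply: fT; rewrite // T0.
have [p pT pmax] := @maximal_comp0 _ gR T T0.
have ps := Ts _ pT; have [g [Fg gi gp]] := loc p ps.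
have [||a ga good'] :=
  @extend_good [seq q <- s | q \notin T] p f g _ gp _ (large _ ps).
- by move=> q; rewrite mem_filter => /andP[qT qs]; exact: fT.
- by move=> q; rewrite mem_filter => /andP[qT qs]; exact: Tmax.
have notin_rem q : q \notin rem p T -> q = p \/ q \notin T.
  rewrite mem_rem_uniq// inE negb_and negbK => /orP[/eqP|]; first by left.
  by right.
apply: (IH (rem p T)).
- by rewrite size_rem//; case: (T) sT.
- exact: rem_uniq.
- by move=> q /mem_rem /Ts.
- move=> q r qs /notin_rem[->|qT] /mem_rem rT; first exact: pmax.
  exact: Tmax.
- exists (f + a *: g); split.
  + by apply: is_submoduleD => //; exact: is_submoduleZ.
  + exact: degree_component_hom.
  + move=> q qs /notin_rem[->|qT]; apply: good'; rewrite inE ?eqxx//.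
    by rewrite mem_filter qT qs orbT.
Qed.
End Extension.

Theorem theorem5p1 (R : comPzRingType) (gR : ring_grading R)
    (M N : lmodType R) (gM : mod_grading gR M) (gN : mod_grading gR N)
    (noethN : noetherian N)
    (large_residue : forall p : spec R, Ass N p ->
       ~~ (residue0 gR p #<=
             `I_(\sum_(p' \in same_degree0 gR N p) socle_rank gR N p')))
    (F : set (Hommod N M)) (gradedF : is_graded_submodule (hom_comp gN gM) F)
    (i : int)
    (locally_injective : forall p : spec R, Ass N p ->
       exists f : Hommod N M,
         [/\ F f, hom_comp gN gM i f & injective (hloc_map gR p f)]) :
  exists f : Hommod N M, [/\ F f, hom_comp gN gM i f & injective f].
Proof.
have [s0 s0E] := (finite_seqP _).1 (finite_Ass noethN).
pose s := undup s0; have sE p : p \in s <-> Ass N p by rewrite mem_undup s0E.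
have [sF _] := gradedF.
have [||||||f [Ff fi fgood]] :=
  @exists_good_everywhere _ gR M N gM gN noethN F i s s sF.
- by move=> p /sE /large_residue.
- move=> p /sE /locally_injective[g [Fg gi ginj]]; exists g; split => //.
  exact: hloc_injective_good ginj.
- exact: undup_uniq.
- by [].
- by move=> q p ->.
(* With every prime still untreated, the zero map is a valid start. *)
- exists 0; split; [by case: sF| |by move=> q ->].
  by move=> j x _; exact: mod_comp0.
exists f; split => //; apply: good_everywhere_injective => // p /sE; exact: fgood.
Qed.
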